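(* For every $m\in\mathbb{N}\cup\{0\}$, the unique measure $\mu^{(m)}$ on $\mathbb{R}$ with moments $\int x^n\,d\mu^{(m)}(x)=M_n^{(m)}$, $n\ge 0$, takes the form $$\mu^{(m)}=\sum_{k=1}^{m+1}b_{m,k}\,\delta_{z_{m,k}},$$ where $$z_{m,k}=2\cos\left(\frac{k\pi}{m+2}\right),\qquad b_{m,k}=\frac{2\sin^2\left(k\pi/(m+2)\right)}{m+2},\qquad k=1,\ldots,m+1.$$
   Context: $\mathbb{N}=\{1,2,\ldots\}$; $\delta_x$ is the Dirac measure at $x$. For $m,n\in\mathbb{N}$, $M_n^{(m)}=|NC_n^{\rm pair}(m)|$; moreover $M_0^{(m)}=1$ for all $m$, and $M_n^{(0)}=\delta_{n,0}$. Here $NC_n^{\rm pair}(m)$ is the set of non-crossing pair partitions of $\{1,\ldots,n\}$ of depth at most $m$ (empty for odd $n$): a pair partition $P=\{P_1,\ldots,P_k\}$ of $\{1,\ldots,2k\}$, $P_j=\{\alpha(j),\beta(j)\}$, $\alpha(j)<\beta(j)$, is non-crossing if there are no $p,q$ with $\alpha(p)<\alpha(q)<\beta(p)<\beta(q)$, and its depth $d(P)$ is the maximal $d$ for which there exist $s_1,\ldots,s_d$ with $\alpha(s_1)<\cdots<\alpha(s_d)$ and $\beta(s_1)>\cdots>\beta(s_d)$. *)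

(* Defs.v *)
From HB Require Import structures.
From mathcomp Require Import all_boot all_order all_algebra.
From mathcomp Require Import all_classical all_reals all_analysis.

Set Implicit Arguments.
Unset Strict Implicit.
Unset Printing Implicit Defensive.

Import Order.TTheory GRing.Theory Num.Theory.
Import numFieldNormedType.Exports.

(* The ground set {1, ..., n} is encoded as 'I_n = {0, ..., n-1}; only the order
   of the points matters below. *)

(* alpha and beta are the left and right endpoints of a block.  For an empty
   block they take junk values, but the blocks of a partition are nonempty. *)
Definition alpha n (B : {set 'I_n}) : nat := \big[minn/n]_(i in B) i.
Definition beta n (B : {set 'I_n}) : nat := \max_(i in B) i.

Definition pair_partition n (P : {set {set 'I_n}}) : bool :=
  finset.partition P [set: 'I_n]%SET && [forall B in P, #|B| == 2].

Definition noncrossing n (P : {set {set 'I_n}}) : bool :=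
  ~~ [exists B in P, exists C in P,
        [&& alpha B < alpha C, alpha C < beta B & beta B < beta C]].

Definition has_nested_chain n (P : {set {set 'I_n}}) (d : nat) : bool :=
  [exists s : d.-tuple {set 'I_n},
     [&& all [in P] s,
         sorted ltn [seq alpha B | B <- s]
       & sorted gtn [seq beta B | B <- s]]].

(* The blocks of a nested chain are pairwise distinct, so the lengths
   d <= #|P| exhaust all possibilities. *)
Definition depth n (P : {set {set 'I_n}}) : nat :=
  \max_(d < #|P|.+1 | has_nested_chain P d) d.

Definition NCpair (n m : nat) : {set {set {set 'I_n}}} :=
  [set P | [&& pair_partition P, noncrossing P & depth P <= m]]%SET.

(* M n m is M_n^{(m)}, with the conventions M_0^{(m)} = 1 and
   M_n^{(0)} = delta_{n,0}. *)
Definition M (n m : nat) : nat :=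
  if n == 0 then 1 else if m == 0 then 0 else #|NCpair n m|.

Local Open Scope ring_scope.

(* Integrability of each monomial is required: the library integral is total
   and can be finite only by convention. *)
Definition has_moments (R : realType)
    (mu : {measure set (measurableTypeR R) -> \bar R}) (a : nat -> R) : Prop :=
  forall n : nat,
    mu.-integrable [set: measurableTypeR R]%classic
      (fun x : measurableTypeR R => ((x : R) ^+ n)%:E) /\
    (\int[mu]_(x in [set: measurableTypeR R]%classic) ((x : R) ^+ n)%:E =
     (a n)%:E)%E.

Definition z (R : realType) (m k : nat) : R := 2 * cos (k%:R * pi / (m + 2)%:R).

Definition b (R : realType) (m k : nat) : R :=
  2 * sin (k%:R * pi / (m + 2)%:R) ^+ 2 / (m + 2)%:R.

(* Main.v *)
Require Import Defs.
From HB Require Import structures.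
From mathcomp Require Import all_boot all_order all_algebra.
From mathcomp Require Import zify ring.
From mathcomp Require Import all_classical all_reals all_analysis.
From mathcomp Require Import measurable_realfun.

Set Implicit Arguments.
Unset Strict Implicit.
Unset Printing Implicit Defensive.

Import Order.TTheory GRing.Theory Num.Theory.
Import numFieldNormedType.Exports.
Local Open Scope classical_set_scope.
Local Open Scope ring_scope.

(** A noncrossing pair partition is determined by its set of left endpoints: the
    number of blocks open at a cut is a height function with steps +1 (left
    endpoint) and -1 (right endpoint), and the partner of a left endpoint is
    where this height first returns.  The blocks open at a cut are nested, so the
    depth is the maximal height; hence M_n^(m) counts closed walks of length n
    from an end of the path graph on the m+1 vertices 0, ..., m.  The vectors
    sin((h+1) k pi / (m+2)) diagonalize its adjacency matrix with eigenvalues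
    2 cos(k pi / (m+2)), which gives the moments of the stated atomic measure.
    Conversely, a measure with these moments gives zero mass to the square of
    prod_k (x - z_k), so it lives on the z_k; there every indicator function
    agrees with a polynomial, and the moments determine the measure. *)

(** * Noncrossing pair partitions and bounded walks *)

(** For [h <= m], this counts the [n]-step walks from [h] to 0 on the path graph with vertices 0,
    ..., m. *)
Fixpoint walks (m n h : nat) : nat :=
  if n is n'.+1 then
    ((if h < m then walks m n' h.+1 else 0) +
     (if h is h'.+1 then walks m n' h' else 0))%N
  else (h == 0).

Section Combinatorics.
Local Open Scope nat_scope.
Local Open Scope set_scope.

(** [H i] is the height just before letter [i], and [true] is an up-step. The start [H 0] stays free
    so that induction can pass to the tail of the word; down-steps are written additively to avoid
    truncated subtraction. *)
Definition profile (w : seq bool) (H : nat -> nat) : Prop :=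
  H (size w) = 0 /\ forall i, i < size w ->
    if nth false w i then H i.+1 = (H i).+1 else H i = (H i.+1).+1.

Fixpoint bounded_word (m h : nat) (w : seq bool) : bool :=
  match w with
  | [::] => h == 0
  | true :: w' => (h < m) && bounded_word m h.+1 w'
  | false :: w' => if h is h'.+1 then bounded_word m h' w' else false
  end.

(** Induction on the word, shifting [H] by one place. Only up-steps are tested against [m], so the
    bound on the starting height has to come from [h <= m]. *)
Lemma bounded_wordP (m h : nat) (w : seq bool) : h <= m ->
  bounded_word m h w <->
  exists H, [/\ H 0 = h, profile w H & forall i, i <= size w -> H i <= m].
Proof.
elim: w h => [|x w IH] h hm /=.
  split=> [/eqP -> |[H [<- [-> _] _]]//].
  by exists (fun=> 0); split.
split.
- move=> bw.
  have [h' [h'm bw' hh']] : exists h', [/\ h' <= m, bounded_word m h' w &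
      if x then h' = h.+1 else h = h'.+1].
    case: x bw => [/andP[]|]; first by exists h.+1.
    by case: h hm => // h hm bw; exists h; split=> //; exact: ltnW.
  have [H [H0 [Hw Hs] Hm]] := (IH _ h'm).1 bw'.
  exists (fun i => if i is j.+1 then H j else h); split=> //.
    split=> // -[_|i /Hs//] /=.
    by case: x hh' {bw}; rewrite H0.
  by case.
- move=> [H [H0 [Hw Hs] Hm]].
  have H1m : H 1 <= m by apply: Hm.
  have bw : bounded_word m (H 1) w.
    apply/IH => //; exists (H \o S); split=> //; last by move=> i iw; apply: Hm.
    by split=> // i iw; apply: (Hs i.+1).
  have := Hs 0 isT; rewrite H0 /=; case: x {Hs Hw} => [e|->//].
  by rewrite e in H1m bw; rewrite H1m bw.
Qed.

Lemma card_bounded_word (m n h : nat) :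
  #|[set w : n.-tuple bool | bounded_word m h w]| = walks m n h.
Proof.
elim: n h => [|n IH] h /=.
  have -> : [set w : 0.-tuple bool | bounded_word m h w] =
            (if h == 0 then finset.setT else finset.set0).
    by apply/setP => w; rewrite inE tuple0 /=; case: eqP; rewrite inE.
  by case: eqP; rewrite ?cards0// cardsT card_tuple expn0.
pose cons_ b (w : n.-tuple bool) : n.+1.-tuple bool := [tuple of b :: w].
have cons_inj b : injective (cons_ b) by move=> u v /(congr1 val)[/val_inj].
have split_words : [set w : n.+1.-tuple bool | bounded_word m h w] =
    [set cons_ true w | w in [set w : n.-tuple bool | bounded_word m h (true :: w)]] :|:
    [set cons_ false w | w in [set w : n.-tuple bool | bounded_word m h (false :: w)]].
  apply/setP => w; rewrite !inE; apply/idP/orP => [bw|].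
    case/tupleP: w bw => -[] w bw; [left|right]; apply/imsetP.
    - by exists w; rewrite ?inE.
    - by exists w; rewrite ?inE.
  by case=> /imsetP[u]; rewrite inE => bu ->.
rewrite split_words cardsU !card_imset//.
rewrite (_ : _ :&: _ = finset.set0); last first.
  by apply/setP => w; rewrite !inE; apply/negP => /andP[/imsetP[u _ ->] /imsetP[v _]].
rewrite cards0 subn0; congr (_ + _).
  case: ifP => hm; first by rewrite -IH; apply: eq_card => w; rewrite !inE /= hm.
  by apply: eq_card0 => w; rewrite !inE /= hm.
case: h {split_words} => [|h]; first by apply: eq_card0 => w; rewrite !inE.
by rewrite -IH; apply: eq_card => w; rewrite !inE.
Qed.

(** The step at [b] undoes the step at [a]: the height after it is [H b.+1], which explains the
    shift of index. *)
Definition first_return (H : nat -> nat) (a b : nat) : Prop :=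
  [/\ a < b, H b.+1 = H a & forall i, a < i <= b -> H a < H i].

Lemma first_return_injr (H : nat -> nat) (a b b' : nat) :
  first_return H a b -> first_return H a b' -> b = b'.
Proof.
move=> [ab Hb Hi] [ab' Hb' Hi']; case: (ltngtP b b') => // bb'.
- by have := Hi' b.+1; rewrite bb' Hb ltnn ltnS (ltnW ab) => /(_ isT).
- by have := Hi b'.+1; rewrite bb' Hb' ltnn ltnS (ltnW ab') => /(_ isT).
Qed.

Lemma first_return_injl (H : nat -> nat) (a a' b : nat) :
  first_return H a b -> first_return H a' b -> a = a'.
Proof.
move=> [ab Hb Hi] [ab' Hb' Hi']; case: (ltngtP a a') => // aa'.
- by have := Hi a'; rewrite aa' (ltnW ab') -Hb Hb' ltnn => /(_ isT).
- by have := Hi' a; rewrite aa' (ltnW ab) -Hb Hb' ltnn => /(_ isT).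
Qed.

(** If [b < b'], then [b.+1] lies inside the excursion from [a'], so [H a' < H b.+1 = H a]; but [a']
    lies inside the excursion from [a], so [H a < H a']. *)
Lemma first_return_nested (H : nat -> nat) (a b a' b' : nat) :
  first_return H a b -> first_return H a' b' -> a < a' -> a' < b -> b' <= b.
Proof.
move=> [ab Hb Hi] [ab' Hb' Hi'] aa' a'b; rewrite leqNgt; apply/negP => bb'.
have := Hi' b.+1; rewrite bb' Hb ltnS (ltnW a'b) => /(_ isT).
by have := Hi a'; rewrite aa' (ltnW a'b) => /(_ isT); lia.
Qed.

Section Profile.
Variables (w : seq bool) (H : nat -> nat).
Hypothesis Hw : profile w H.

Lemma profile_up (i : nat) : i < size w -> nth false w i -> H i.+1 = (H i).+1.
Proof. by move=> /Hw.2; case: ifP. Qed.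

Lemma profile_down (i : nat) :
  i < size w -> ~~ nth false w i -> H i = (H i.+1).+1.
Proof. by move=> /Hw.2; case: ifP. Qed.

Lemma first_return_left (a b : nat) :
  b < size w -> first_return H a b -> nth false w a.
Proof.
move=> bw [ab _ Hi]; apply/negPn/negP => /profile_down.
have := Hi a.+1; rewrite ltnSn ab => /(_ isT).
by move=> ? /(_ (ltn_trans ab bw)); lia.
Qed.

Lemma first_return_right (a b : nat) :
  b < size w -> first_return H a b -> ~~ nth false w b.
Proof.
move=> bw [ab Hb Hi]; apply/negP => /(profile_up bw).
by have := Hi b; rewrite ab leqnn => /(_ isT); lia.
Qed.

(** Take the least [b > a] with [H b.+1 <= H a]. It exists because the final height is 0, and since
    steps have size one the inequality is an equality. *)
Lemma ex_first_return_right (a : nat) : a < size w -> nth false w a ->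
  exists2 b, b < size w & first_return H a b.
Proof.
move=> aw wa; have Ha := profile_up aw wa.
have ex : exists b, (a < b < size w) && (H b.+1 <= H a).
  exists (size w).-1; have -> : (size w).-1.+1 = size w by lia.
  rewrite Hw.1 leq0n andbT.
  suff : a.+1 != size w by lia.
  by apply/eqP => e; move: Ha; rewrite e Hw.1.
have [b /andP[/andP[ab bw] Hb] bmin] := ex_minnP ex.
have Hi i : a < i <= b -> H a < H i.
  case: i => // i /andP[]; rewrite ltnS leq_eqVlt => /predU1P[<- _|ai ib].
    by rewrite Ha.
  rewrite ltnNge; apply/negP => Hi; have := bmin i.
  by rewrite ai (ltn_trans ib bw) Hi leqNgt ib => /(_ isT).
exists b => //; split=> //; have := Hi b; rewrite ab leqnn => /(_ isT) Hab.
by have := Hw.2 b bw; case: ifP; lia.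
Qed.

(** The mirror argument takes the largest [a <= b] with [H a <= H b.+1]; the index 0 qualifies
    because [H 0 = 0]. *)
Lemma ex_first_return_left (b : nat) : H 0 = 0 ->
  b < size w -> ~~ nth false w b -> exists a, first_return H a b.
Proof.
move=> H0 bw wb; have Hb := profile_down bw wb.
have ex : exists a, (a <= b) && (H a <= H b.+1).
  by exists 0; rewrite H0 !leq0n.
have bound a : (a <= b) && (H a <= H b.+1) -> a <= b by case/andP.
have [a /andP[ab Ha] amax] := ex_maxnP ex bound.
have {}ab : a < b by rewrite ltn_neqAle ab andbT; apply/eqP => e; rewrite e Hb ltnn in Ha.
have Hi i : a < i <= b -> H b.+1 < H i.
  move=> /andP[ai ib]; rewrite ltnNge; apply/negP => Hi.
  by have := amax i; rewrite ib Hi leqNgt ai => /(_ isT).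
have Hab : H b.+1 = H a.
  have := Hi a.+1; rewrite ltnSn ab => /(_ isT).
  by have := Hw.2 a (ltn_trans ab bw); case: ifP; lia.
by exists a; split=> // i; rewrite -Hab; exact: Hi.
Qed.

End Profile.

Lemma profile_uniq (w : seq bool) (H H' : nat -> nat) :
  profile w H -> profile w H' -> H 0 = H' 0 ->
  forall i, i <= size w -> H i = H' i.
Proof.
move=> Hw Hw' H0; elim=> // i IH iw; have := IH (ltnW iw).
by have := Hw.2 i iw; have := Hw'.2 i iw; case: ifP; lia.
Qed.

(** * Endpoints of blocks, cuts and depth *)

Section Endpoints.
Variable n : nat.

Lemma beta_pair (a c : 'I_n) : a < c -> beta [set a; c] = c.
Proof.
move=> ac; apply/eqP; rewrite eqn_leq; apply/andP; split.
  by apply/bigmax_leqP => i; rewrite !inE => /orP[]/eqP ->; rewrite ?(ltnW ac).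
by apply: (leq_bigmax_cond (F := fun i : 'I_n => i : nat)); rewrite !inE eqxx orbT.
Qed.

Lemma alpha_pair (a c : 'I_n) : a < c -> alpha [set a; c] = a.
Proof.
move=> ac; set B := [set a; c].
have lb : alpha B <= a.
  rewrite /alpha; have : a \in index_enum 'I_n by rewrite mem_index_enum.
  elim: (index_enum _) => // i r IH; rewrite inE big_cons => /predU1P[<-|/IH le].
    by rewrite !inE eqxx /= geq_minl.
  by case: ifP => // _; rewrite geq_min le orbT.
(* A minimum is attained or equals its default [n]; the default is excluded by [lb], since
   [a < n]. *)
have : alpha B = n \/ exists2 i : 'I_n, i \in B & alpha B = i.
  rewrite /alpha; elim/big_rec: _ => [|i x iB IH]; first by left.
  rewrite /minn; case: ifP => _ //; right; by exists i.
case=> [e|[i]]; first by move: lb; rewrite e leqNgt ltn_ord.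
by rewrite !inE => /orP[]/eqP -> // e; move: lb; rewrite e leqNgt ac.
Qed.

End Endpoints.

Section PairPartition.
Variables (n : nat) (P : {set {set 'I_n}}).
Hypothesis pP : pair_partition P.

Lemma block_pair (B : {set 'I_n}) : B \in P ->
  exists a c : 'I_n, [/\ a < c, B = [set a; c], alpha B = a & beta B = c].
Proof.
case/andP: pP => _ /forall_inP P2 /P2/cards2P[a [c [ac ->]]].
wlog lt_ac : a c ac / a < c => [W|].
  case: (ltngtP a c) => [|ca|/val_inj e]; first exact: W.
    by rewrite finset.setUC; apply: W => //; rewrite eq_sym.
  by rewrite e eqxx in ac.
by exists a, c; rewrite alpha_pair ?beta_pair.
Qed.

Lemma block_eq (B C : {set 'I_n}) (i : 'I_n) :
  B \in P -> C \in P -> i \in B -> i \in C -> B = C.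
Proof.
case/andP: pP => /and3P[_ /def_pblock tr _] _ BP CP iB iC.
by rewrite -(tr _ _ BP iB) (tr _ _ CP iC).
Qed.

Lemma block_cover (i : 'I_n) :
  exists2 B, B \in P & alpha B = i \/ beta B = i.
Proof.
case/andP: pP => /and3P[/eqP cov _ _] _.
have /bigcupP[B BP] : i \in finset.cover P by rewrite cov inE.
have [a [c [_ eB aB bB]]] := block_pair BP.
by rewrite {1}eB !inE => /orP[]/eqP ->; exists B; rewrite ?aB ?bB; auto.
Qed.

Lemma alpha_lt_beta (B : {set 'I_n}) : B \in P -> alpha B < beta B.
Proof. by move=> /block_pair[a [c [ac _ -> ->]]]. Qed.

Lemma beta_lt (B : {set 'I_n}) : B \in P -> beta B < n.
Proof. by move=> /block_pair[a [c [_ _ _ ->]]]. Qed.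

Lemma alpha_inj : {in P &, injective (@alpha n)}.
Proof.
move=> B C BP CP.
have [a [c [_ eB -> _]]] := block_pair BP.
have [a' [c' [_ eC -> _]]] := block_pair CP => /val_inj e.
by apply: (block_eq BP CP (i := a)); rewrite ?eB ?eC ?e !inE eqxx.
Qed.

Lemma beta_inj : {in P &, injective (@beta n)}.
Proof.
move=> B C BP CP.
have [a [c [_ eB _ ->]]] := block_pair BP.
have [a' [c' [_ eC _ ->]]] := block_pair CP => /val_inj e.
by apply: (block_eq BP CP (i := c)); rewrite ?eB ?eC ?e !inE eqxx orbT.
Qed.

Lemma alpha_neq_beta (B C : {set 'I_n}) : B \in P -> C \in P ->
  alpha B <> beta C.
Proof.
move=> BP CP.
have [a [c [ac eB aB _]]] := block_pair BP.
have [a' [c' [ac' eC aC bC]]] := block_pair CP.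
rewrite aB bC => /val_inj e.
have BC : B = C by apply: (block_eq BP CP (i := a)); rewrite ?eB ?eC ?e !inE eqxx ?orbT.
by move: ac'; rewrite -e -aC -BC aB ltnn.
Qed.

(** The blocks open in the gap just before position [k]; their number will be the height there. *)
Definition cut (k : nat) : {set {set 'I_n}} :=
  [set B in P | alpha B < k <= beta B].

(** The Dyck word of the partition, with up-steps at left endpoints. *)
Definition opens : n.-tuple bool :=
  [tuple [exists B in P, alpha B == i :> nat] | i < n].

Lemma nth_opens (i : nat) : i < n ->
  nth false opens i = [exists B in P, alpha B == i].
Proof. by move=> ni; rewrite -[i]/(val (Ordinal ni)) -tnth_nth tnth_mktuple. Qed.

(** Passing the position [alpha B] changes the status of [B] alone, because no other block has an
    endpoint there. *)
Lemma card_cut_opener (B : {set 'I_n}) : B \in P ->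
  #|cut (alpha B).+1| = #|cut (alpha B)|.+1.
Proof.
move=> BP; have -> : cut (alpha B).+1 = B |: cut (alpha B).
  apply/setP => C; rewrite !inE; have [CP|CP] := boolP (C \in P); last first.
    by rewrite orbF; apply/esym/negP => /eqP e; rewrite e BP in CP.
  case: eqP => [->|CB] /=; first by rewrite ltnSn alpha_lt_beta.
  have := alpha_neq_beta BP CP.
  have : alpha C <> alpha B by move/(alpha_inj CP BP).
  by lia.
by rewrite cardsU1 !inE ltnn andbF.
Qed.

Lemma card_cut_closer (B : {set 'I_n}) : B \in P ->
  #|cut (beta B)| = #|cut (beta B).+1|.+1.
Proof.
move=> BP; have -> : cut (beta B) = B |: cut (beta B).+1.
  apply/setP => C; rewrite !inE; have [CP|CP] := boolP (C \in P); last first.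
    by rewrite orbF; apply/esym/negP => /eqP e; rewrite e BP in CP.
  case: eqP => [->|CB] /=; first by rewrite leqnn alpha_lt_beta.
  have := alpha_neq_beta CP BP.
  have : beta C <> beta B by move/(beta_inj CP BP).
  by lia.
by rewrite cardsU1 !inE ltnn !andbF.
Qed.

Lemma card_cut0 : #|cut 0| = 0.
Proof. by apply: eq_card0 => B; rewrite !inE andbF. Qed.

Lemma profile_cut : profile opens (fun k => #|cut k|).
Proof.
rewrite /profile size_tuple; split.
  apply: eq_card0 => B; rewrite !inE; apply/negP => /and3P[/beta_lt].
  by rewrite ltnNge => /negP.
move=> i ni; rewrite nth_opens//.
case: ifPn => [/exists_inP[B BP /eqP <-]|]; first exact: card_cut_opener.
have [B BP [e|e]] := block_cover (Ordinal ni).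
  by case/negP; apply/exists_inP; exists B => //; apply/eqP.
by move=> _; have /= <- := e; exact: card_cut_closer.
Qed.

(** All blocks of a chain are open just before the right endpoint of the innermost one, which is the
    last entry of the tuple. *)
Lemma nested_chain_le (d : nat) : has_nested_chain P d ->
  exists2 k, k <= n & d <= #|cut k|.
Proof.
case/existsP => s /and3P[/allP sP sa sb].
case: d s sP sa sb => [|d] s sP sa sb; first by exists 0.
have [B0 [t es]] : exists B0 t, s = rcons t B0 :> seq _.
  by case/lastP: (val s) (size_tuple s) => // t B0 _; exists B0, t.
have B0s : B0 \in tval s by rewrite es mem_rcons mem_head.
have B0P := sP _ B0s.
exists (beta B0); first exact: ltnW (beta_lt B0P).
have us : uniq s.
  by apply: (map_uniq (f := @alpha n)); apply: sorted_uniq sa; [exact: ltn_trans|exact: ltnn].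
rewrite -(size_tuple s) -(card_uniqP us); apply: subset_leq_card.
apply/fintype.subsetP => B Bs; rewrite !inE sP//=.
move: Bs; rewrite es mem_rcons inE => /predU1P[->|Bt].
  by rewrite alpha_lt_beta //=.
move: sa sb; rewrite es !map_rcons.
rewrite !(sorted_pairwise ltn_trans) !(sorted_pairwise (rev_trans ltn_trans)).
rewrite !pairwise_rcons => /andP[/allP la _] /andP[/allP lb _].
have := la _ (map_f _ Bt); have := lb _ (map_f _ Bt) => /= lb' la'.
by rewrite (ltn_trans la' (alpha_lt_beta B0P)) ltnW.
Qed.

Hypothesis ncP : noncrossing P.

Lemma noncrossingP (B C : {set 'I_n}) : B \in P -> C \in P ->
  alpha B < alpha C -> alpha C < beta B -> beta C < beta B.
Proof.
move=> BP CP aa ab; rewrite ltnNge leq_eqVlt; apply/negP => /predU1P[|bb].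
  by move=> /(beta_inj BP CP) e; rewrite e ltnn in aa.
move/negP: ncP; apply; apply/exists_inP; exists B => //.
by apply/exists_inP; exists C => //; apply/and3P.
Qed.

(** By noncrossing, a block open just before [alpha B] encloses [B], and so does one open just after
    [beta B], so these two cuts agree. In between, the same blocks are still open and [B] is open as
    well. *)
Lemma first_return_block (B : {set 'I_n}) : B \in P ->
  first_return (fun k => #|cut k|) (alpha B) (beta B).
Proof.
move=> BP; have ab := alpha_lt_beta BP; split=> //.
  apply: eq_card => C; rewrite !inE; have [CP|//] := boolP (C \in P) => /=.
  have [<-|/eqP CB] := eqVneq B C; first by rewrite !ltnn andbF.
  have ac := alpha_lt_beta CP.
  have nBC := noncrossingP BP CP; have nCB := noncrossingP CP BP.
  have e1 : alpha B <> alpha C by move/(alpha_inj BP CP).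
  have e2 := alpha_neq_beta BP CP; have e3 := alpha_neq_beta CP BP.
  by apply/andP/andP => -[h1 h2]; split; lia.
move=> i /andP[ai ib]; apply: proper_card; apply/fintype.properP; split.
  apply/fintype.subsetP => C; rewrite !inE => /and3P[CP CB BC]; rewrite CP (ltn_trans CB ai)/=.
  have e2 := alpha_neq_beta BP CP.
  by have := noncrossingP CP BP CB; lia.
by exists B; rewrite !inE ?BP ?ai ?ib ?ltnn// andbF.
Qed.

(** Sort the open blocks by left endpoint. If [alpha B < alpha C] in a common cut, then
    [alpha C < k <= beta B], and noncrossing forces [beta C < beta B]. *)
Lemma has_nested_chain_cut (k : nat) : has_nested_chain P #|cut k|.
Proof.
pose le := relpre (@alpha n) leq.
have le_total : total le by move=> B C; exact: leq_total.
have sz : size (sort le (enum (cut k))) == #|cut k| by rewrite size_sort -cardE.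
apply/existsP; exists (Tuple sz) => /=.
have mem_s B : B \in sort le (enum (cut k)) -> B \in cut k by rewrite mem_sort mem_enum.
have cutP B : B \in cut k -> B \in P by rewrite inE => /andP[].
have sorted_alpha : sorted ltn [seq alpha B | B <- sort le (enum (cut k))].
  rewrite ltn_sorted_uniq_leq sorted_map (sort_sorted le_total) andbT.
  rewrite map_inj_in_uniq ?sort_uniq ?enum_uniq// => B C /mem_s/cutP BP /mem_s/cutP CP.
  exact: alpha_inj.
apply/and3P; split=> //.
  by apply/allP => B /mem_s/cutP.
move: sorted_alpha; rewrite !sorted_map.
apply: (sub_in_sorted (P := mem (cut k))); last by apply/allP => B /mem_s.
move=> B C Bk Ck /= BC; apply: noncrossingP BC _; try exact: cutP.
by move: Bk Ck; rewrite !inE => /and3P[_ _ kB] /and3P[_ Ck _]; exact: leq_trans kB.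
Qed.

(** Every nested chain fits into a single cut, and every cut is itself a nested chain. *)
Lemma depth_leP (m : nat) :
  depth P <= m <-> forall k, k <= n -> #|cut k| <= m.
Proof.
split=> [dm k kn|cm].
  have ckP : #|cut k| < #|P|.+1.
    by rewrite ltnS subset_leq_card//; apply/fintype.subsetP => B; rewrite inE => /andP[].
  apply: leq_trans dm; rewrite /depth.
  have := @leq_bigmax_cond _ (fun d : 'I_#|P|.+1 => has_nested_chain P d)
    (fun d => d : nat) (Ordinal ckP).
  by apply; exact: has_nested_chain_cut.
apply/bigmax_leqP => d /nested_chain_le[k /cm ckm dc].
exact: leq_trans ckm.
Qed.

End PairPartition.

(** * The bijection between partitions and bounded words *)

Lemma opens_inj (n m : nat) : {in NCpair n m &, injective (@opens n)}.
Proof.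
(* By symmetry one inclusion suffices. Equal words have equal heights, and the heights determine the
   partner of each left endpoint as its first return. *)
suff sub P Q : P \in NCpair n m -> Q \in NCpair n m -> opens P = opens Q -> P \subset Q.
  by move=> P Q PN QN e; apply/eqP; rewrite finset.eqEsubset !sub.
rewrite !inE => /and3P[pP ncP _] /and3P[pQ ncQ _] e.
have cutE k : k <= n -> #|cut P k| = #|cut Q k|.
  move=> kn; have profQ := profile_cut pQ; rewrite -e in profQ.
  by apply: (profile_uniq (profile_cut pP) profQ); rewrite ?card_cut0 ?size_tuple.
apply/fintype.subsetP => B BP.
have an : alpha B < n := ltn_trans (alpha_lt_beta pP BP) (beta_lt pP BP).
have /exists_inP[C CQ /eqP aCB] : [exists C in Q, alpha C == alpha B].
  by rewrite -nth_opens// -e nth_opens//; apply/exists_inP; exists B.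
have bCB : beta C = beta B.
  have rC := first_return_block pQ ncQ CQ; rewrite aCB in rC.
  apply: first_return_injr rC _.
  have [ab Hb Hi] := first_return_block pP ncP BP.
  have bn := beta_lt pP BP.
  split=> //; first by rewrite -!cutE// ltnW.
  move=> i /[dup] /Hi lt_i /andP[_ ib].
  by rewrite -!cutE//; [exact: leq_trans ib (ltnW bn) | exact: ltnW].
suff -> : B = C by [].
have [a [c [_ eB aB bB]]] := block_pair pP BP.
have [a' [c' [_ eC aC bC]]] := block_pair pQ CQ.
rewrite eB eC; congr [set _; _]; apply: val_inj => /=.
  by rewrite -aB -aC.
by rewrite -bB -bC.
Qed.

Lemma opens_surj (n m : nat) (w : n.-tuple bool) :
  bounded_word m 0 w -> exists2 P, P \in NCpair n m & w = opens P.
Proof.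
move=> /(bounded_wordP _ (leq0n m))[H [H0 Hw Hm]].
have sw : size w = n by rewrite size_tuple.
(* The inverse construction: pair each up-step with its first return. *)
pose P : {set {set 'I_n}} :=
  [set [set p.1; p.2] | p in [pred p : 'I_n * 'I_n | `[< first_return H p.1 p.2 >]]].
have PP B : B \in P <-> exists a c : 'I_n, first_return H a c /\ B = [set a; c].
  split=> [/imsetP[[a c]]|[a [c [r ->]]]].
    by move=> r ->; exists a, c; split=> //; exact: (asboolW r).
  by apply/imsetP; exists (a, c) => //; exact: (asboolT r).
have lt_ret a c : first_return H a c -> a < c by case.
have isopen (a c : 'I_n) : first_return H a c -> nth false w a.
  by move=> r; apply: (first_return_left Hw _ r); rewrite sw.
have isclosed (a c : 'I_n) : first_return H a c -> ~~ nth false w c.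
  by move=> r; apply: (first_return_right Hw _ r); rewrite sw.
have pP : pair_partition P.
  apply/andP; split; last first.
    apply/forall_inP => B /PP[a [c [/lt_ret ac ->]]].
    by rewrite cards2; case: (a =P c) => // e; rewrite e ltnn in ac.
  apply/and3P; split.
  - apply/eqP/setP => i; rewrite inE; apply/bigcupP.
    have iw : i < size w by rewrite sw.
    have [wi|wi] := boolP (nth false w i).
      have [c] := ex_first_return_right Hw iw wi; rewrite sw => cn r.
      exists [set i; Ordinal cn]; last by rewrite !inE eqxx.
      by apply/PP; exists i, (Ordinal cn).
    have [a r] := ex_first_return_left Hw H0 iw wi.
    have an : a < n by rewrite (ltn_trans (lt_ret _ _ r)).
    exists [set Ordinal an; i]; last by rewrite !inE eqxx orbT.
    by apply/PP; exists (Ordinal an), i.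
  (* Blocks sharing a left endpoint, or a right one, coincide by uniqueness of first returns. A left
     endpoint is never a right endpoint, because [w] is true at the former and false at the
     latter. *)
  - apply/finset.trivIsetP => B C /PP[a [c [r ->]]] /PP[a' [c' [r' ->]]] neq.
    rewrite -finset.setI_eq0; apply/eqP/setP => i; rewrite !inE; apply/negP => /andP[].
    move=> /orP[]/eqP -> /orP[]/eqP e; move: neq; rewrite e.
    + rewrite e in r; have /val_inj -> := first_return_injr r r'.
      by rewrite eqxx.
    + by have := isclosed _ _ r'; rewrite -e (isopen _ _ r).
    + by have := isclosed _ _ r; rewrite e (isopen _ _ r').
    + rewrite e in r; have /val_inj -> := first_return_injl r r'.
      by rewrite eqxx.
  - apply/negP => /PP[a [c [_ /setP/(_ a)]]].
    by rewrite !inE eqxx.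
have ncP : noncrossing P.
  apply/negP => /exists_inP[B /PP[a [c [r ->]]] /exists_inP[C /PP[a' [c' [r' ->]]]]].
  have ac := lt_ret _ _ r; have ac' := lt_ret _ _ r'.
  rewrite !alpha_pair// !beta_pair// => /and3P[aa' a'c].
  by rewrite ltnNge (first_return_nested r r').
have wE : w = opens P.
  apply: eq_from_tnth => i; rewrite tnth_mktuple (tnth_nth false).
  apply/idP/exists_inP => [wi|[B /PP[a [c [r ->]]]]].
    have iw : i < size w by rewrite sw.
    have [c] := ex_first_return_right Hw iw wi; rewrite sw => cn r.
    exists [set i; Ordinal cn]; first by apply/PP; exists i, (Ordinal cn).
    by rewrite alpha_pair//; exact: lt_ret r.
  by rewrite alpha_pair ?(lt_ret _ _ r)// => /eqP/val_inj <-; exact: isopen r.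
exists P => //; rewrite inE pP ncP /=.
apply/(depth_leP pP ncP) => k kn.
(* Both are height functions of the same word starting at 0. *)
have -> : #|cut P k| = H k.
  have profP := profile_cut pP; rewrite -wE in profP.
  by apply: (profile_uniq profP Hw); rewrite ?sw ?card_cut0.
by apply: Hm; rewrite sw.
Qed.

Lemma card_NCpair (n m : nat) : #|NCpair n m| = walks m n 0.
Proof.
rewrite -card_bounded_word -(card_in_imset (@opens_inj n m)).
apply: eq_card => w; rewrite inE; apply/imsetP/idP => [[P]|/opens_surj//].
rewrite inE => /and3P[pP ncP /(depth_leP pP ncP) dP] ->.
apply/bounded_wordP => //; exists (fun k => #|cut P k|).
by rewrite card_cut0 size_tuple; split=> //; exact: profile_cut.
Qed.

(** The conventions fit the walk count: only the empty walk has length 0, and a path with one vertex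
    admits no step. *)
Lemma M_walks (n m : nat) : M n m = walks m n 0.
Proof.
rewrite /M; case: n => [|n] //=.
by case: m => [|m] //=; rewrite card_NCpair.
Qed.

End Combinatorics.

(** * Spectral decomposition of the path graph *)

Section Spectral.
Variables (R : realType) (N : nat).
Hypothesis N_gt0 : (0 < N)%N.

(** With [N = m.+2] these are the angles in [z] and [b]. *)
Definition angle (j : nat) : R := j%:R * pi / N%:R.

Lemma angleM (j k : nat) : angle (j * k) = j%:R * angle k.
Proof. by rewrite /angle natrM !mulrA. Qed.

Lemma sin_natpi (j : nat) : sin (j%:R * pi : R) = 0.
Proof.
elim: j => [|j IH]; first by rewrite mul0r sin0.
by rewrite -addn1 natrD mulrDl mul1r sinDpi IH oppr0.
Qed.

Lemma cos_natpi (j : nat) : cos (j%:R * pi : R) = (-1) ^+ j.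
Proof.
elim: j => [|j IH]; first by rewrite mul0r cos0.
by rewrite -addn1 natrD mulrDl mul1r cosDpi IH addn1 exprS mulN1r.
Qed.

(* Multiplying by [2 * sin (angle j / 2)] makes the sum telescope. *)
Lemma sum_cos_angle (j : nat) : (0 < j < N.*2)%N ->
  \sum_(k < N) cos (angle (j * k)) = (1 - (-1) ^+ j) / 2.
Proof.
case/andP=> j_gt0 j_lt; pose a : R := angle j / 2.
have N0 : (0 : R) < N%:R by rewrite ltr0n.
(* The bounds on [j] place [a], which is j pi / (2N), strictly between 0 and pi. *)
have sa : sin a != 0.
  apply: lt0r_neq0; apply: sin_gt0_pi; rewrite /a /angle -mulrA -invfM.
  rewrite divr_gt0 ?mulr_gt0 ?ltr0n ?pi_gt0//=.
  rewrite ltr_pdivrMr ?mulr_gt0// [ltRHS]mulrC ltr_pM2r ?pi_gt0//.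
  by rewrite -natrM ltr_nat muln2.
have tele k : cos (angle (j * k)) * (2 * sin a) =
    sin (k.+1%:R * angle j - a) - sin (k%:R * angle j - a).
  have -> : angle (j * k) = k%:R * angle j by rewrite mulnC angleM.
  have -> : k.+1%:R * angle j - a = k%:R * angle j + a.
    rewrite -addn1 natrD mulrDl mul1r -addrA; congr +%R.
    by rewrite {1}(splitr (angle j)) addrK.
  by rewrite sinD sinB; ring.
apply: (mulIf (x := 2 * sin a)); first by rewrite mulf_neq0.
rewrite mulr_suml (eq_bigr _ (fun (k : 'I_N) _ => tele k)).
rewrite -(big_mkord xpredT (fun k => sin (k.+1%:R * angle j - a) - sin (k%:R * angle j - a))).
rewrite (telescope_sumr (fun k => sin (k%:R * angle j - a)))//.
have -> : N%:R * angle j = j%:R * pi by rewrite /angle mulrC divfK// lt0r_neq0.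
rewrite sinB sin_natpi cos_natpi mul0r sub0r mul0r sub0r sinN.
by field.
Qed.

(** Orthogonality of the sine vectors. The product formula leaves cosine sums of frequencies [h] and
    [h.+2], of equal parity, which cancel; for [h = 0] the first sum is [N] and the second is 0. *)
Lemma sum_sin_angle (h : nat) : (h.+2 < N.*2)%N ->
  \sum_(k < N) sin (angle k) * sin (angle (h.+1 * k)) = (h == 0)%:R * N%:R / 2.
Proof.
move=> hN.
have prod k : sin (angle k) * sin (angle (h.+1 * k)) =
    (cos (angle (h * k)) - cos (angle (h.+2 * k))) / 2.
  rewrite !angleM.
  have -> : h%:R * angle k = h.+1%:R * angle k - angle k.
    by rewrite -[h.+1]addn1 natrD; ring.
  have -> : h.+2%:R * angle k = h.+1%:R * angle k + angle k.
    by rewrite -[h.+2]addn1 natrD; ring.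
  by rewrite cosB cosD; field.
rewrite (eq_bigr _ (fun (k : 'I_N) _ => prod k)) -mulr_suml sumrB.
rewrite [X in _ - X]sum_cos_angle//.
case: h hN {prod} => [|h] hN /=.
  under eq_bigr => k _ do rewrite mul0n /angle !mul0r cos0.
  by rewrite sumr_const card_ord expr2 mulrNN !mul1r subrr mul0r subr0.
rewrite sum_cos_angle; last by rewrite /= (leq_trans _ hN)// leqW.
by rewrite !exprS !mulN1r !opprK subrr !mul0r.
Qed.

End Spectral.

(** Induction on [n]. Orthogonality is the base case, and [m.+2%:R / 2] is the squared norm of an
    eigenvector. The step is the eigenvector equation [rec], whose two terms correspond to an
    up-step and a down-step. *)
Lemma walks_spectral (R : realType) (m n h : nat) : (h <= m)%N ->
  (walks m n h)%:R * (m.+2%:R / 2) =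
  \sum_(k < m.+2) sin (angle R m.+2 k) * sin (angle R m.+2 (h.+1 * k)) *
                  (2 * cos (angle R m.+2 k)) ^+ n.
Proof.
elim: n h => [|n IH] h hm /=.
  under eq_bigr => k _ do rewrite expr0 mulr1.
  rewrite sum_sin_angle ?mulrA//.
  by rewrite -addnn addSn !ltnS (leq_ltn_trans hm)// ltn_addl.
have rec (k : nat) : sin (angle R m.+2 (h.+1 * k)) * (2 * cos (angle R m.+2 k)) =
   sin (angle R m.+2 (h.+2 * k)) + sin (angle R m.+2 (h * k)).
  rewrite !angleM.
  have -> : h%:R * angle R m.+2 k = h.+1%:R * angle R m.+2 k - angle R m.+2 k.
    by rewrite -[h.+1]addn1 natrD; ring.
  have -> : h.+2%:R * angle R m.+2 k = h.+1%:R * angle R m.+2 k + angle R m.+2 k.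
    by rewrite -[h.+2]addn1 natrD; ring.
  by rewrite sinB sinD; ring.
transitivity (\sum_(k < m.+2)
    (sin (angle R m.+2 k) * sin (angle R m.+2 (h.+2 * k)) * (2 * cos (angle R m.+2 k)) ^+ n
   + sin (angle R m.+2 k) * sin (angle R m.+2 (h * k)) * (2 * cos (angle R m.+2 k)) ^+ n)).
  rewrite big_split/= natrD mulrDl; congr +%R.
    (* At the top vertex there is no up-step, and the corresponding sines vanish, being those of k
       pi. *)
    case: ltnP => [hm'|mh]; first exact: IH.
    have -> : h = m by apply/eqP; rewrite eqn_leq hm.
    rewrite mul0r big1// => k _.
    by rewrite angleM /angle mulrCA divff ?pnatr_eq0// mulr1 sin_natpi mulr0 mul0r.
  (* At the bottom vertex there is no down-step, and the corresponding sines are [sin 0]. *)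
  case: h hm {rec} => [|h] hm; last by apply: IH; exact: ltnW.
  rewrite mul0r big1// => k _.
  by rewrite /angle ?mul0n !mul0r sin0 mulr0 mul0r.
apply: eq_bigr => k _.
by rewrite -mulrDl -mulrDr -rec exprS; ring.
Qed.

Lemma walks_moment (R : realType) (m n : nat) :
  (walks m n 0)%:R = \sum_(k < m.+1) b R m k.+1 * z R m k.+1 ^+ n.
Proof.
have N0 : m.+2%:R != 0 :> R by rewrite pnatr_eq0.
have /(canRL (mulfK _)) -> := @walks_spectral R m n 0 (leq0n _); last first.
  by rewrite mulf_neq0// invr_neq0.
(* The term of index 0 vanishes, so the sum runs over the indices 1, ..., m+1 of the atoms. *)
rewrite big_ord_recl/= {1}/angle !mul0r sin0 !mul0r add0r mulr_suml.
apply: eq_bigr => k _; rewrite /b /z /angle mul1n addn2 [bump _ _]add1n.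
by field.
Qed.

(** * Moments of finitely supported measures *)

Section AtomicMeasure.
Context d (T : measurableType d) (R : realType).
Variables (c : nat -> {nonneg R}) (x : nat -> T) (N : nat).

Definition atomic : {measure set T -> \bar R} :=
  msum (fun k => mscale (c k) \d_(x k)) N.

Lemma atomicE (A : set T) :
  atomic A = (\sum_(k < N) ((c k)%:num)%:E * \d_(x k) A)%E.
Proof. by []. Qed.

Lemma ge0_integral_atomic (f : T -> R) : measurable_fun setT f ->
  (forall t, 0 <= f t) ->
  (\int[atomic]_t (f t)%:E)%E = (\sum_(k < N) (c k)%:num * f (x k))%:E.
Proof.
move=> /measurable_EFinP mf f0.
rewrite ge0_integral_measure_sum//; last by move=> t _; rewrite lee_fin.
rewrite -sumEFin; apply: eq_bigr => k _.
rewrite ge0_integral_mscale//; last by move=> t _; rewrite lee_fin.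
by rewrite integral_dirac// diracT mul1e.
Qed.

Lemma integrable_atomic (f : T -> R) : measurable_fun setT f ->
  atomic.-integrable setT (EFin \o f).
Proof.
move=> mf; apply/integrableP; split; first exact/measurable_EFinP.
rewrite (ge0_integral_atomic (f := fun t => `|f t|)) ?ltry//.
exact: measurableT_comp.
Qed.

Lemma integral_atomic (f : T -> R) : measurable_fun setT f ->
  (\int[atomic]_t (f t)%:E)%E = (\sum_(k < N) (c k)%:num * f (x k))%:E.
Proof.
move=> mf; have mp := measurable_funrpos mf; have mn := measurable_funrneg mf.
transitivity (\int[atomic]_t ((f^\+ t)%:E - (f^\- t)%:E))%E.
  by apply: eq_integral => t _; rewrite -EFinB -[in LHS](funrposBneg f).
rewrite integralB//; [|exact: integrable_atomic..].
rewrite !ge0_integral_atomic// -EFinB -sumrB; congr EFin.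
by apply: eq_bigr => k _; rewrite -mulrBr -[in RHS](funrposBneg f).
Qed.

End AtomicMeasure.

(** * Recovering a measure from its moments *)

Lemma exists_interpolating_poly (F : fieldType) (g : F -> F) (s : seq F) :
  exists p : {poly F}, {in s, forall y, p.[y] = g y}.
Proof.
elim: s => [|y s [p ps]]; first by exists 0.
pose q := \prod_(u <- s) ('X - u%:P).
(* Newton's correction: [q] vanishes at the earlier nodes, so only the value at a new node changes.
   A repeated node falls under the first case. *)
exists (p + ((g y - p.[y]) / q.[y]) *: q) => u; rewrite hornerD hornerZ.
have [us _|us] := boolP (u \in s).
  have /rootP -> : root q u by rewrite root_prod_XsubC.
  by rewrite mulr0 addr0 ps.
rewrite inE (negbTE us) orbF => /eqP uy; rewrite {u}uy in us *.
have qy : q.[y] != 0 by rewrite -rootE root_prod_XsubC.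
by rewrite divfK// addrC subrK.
Qed.

Section FiniteMoments.
Variables (R : realType) (nu : {measure set (measurableTypeR R) -> \bar R}).
Variables (N : nat) (c x : nat -> R).
Hypothesis nu_moments :
  has_moments nu (fun n => \sum_(k < N) c k * x k ^+ n).

Lemma integrable_horner (p : {poly R}) :
  nu.-integrable setT (fun t : measurableTypeR R => (p.[t])%:E).
Proof.
under eq_fun => t do rewrite horner_coef -sumEFin.
apply: integrable_sum => // i _.
under eq_fun => t do rewrite EFinM.
by apply: integrableZl => //; exact: (nu_moments i).1.
Qed.

Lemma integral_horner (p : {poly R}) :
  (\int[nu]_(t in [set: measurableTypeR R]) (p.[t])%:E)%E =
    (\sum_(k < N) c k * p.[x k])%:E.
Proof.
under eq_integral => t _ do rewrite horner_coef -sumEFin.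
rewrite integral_sum//; last first.
  move=> i; under eq_fun => t do rewrite EFinM.
  by apply: integrableZl => //; exact: (nu_moments i).1.
transitivity (\sum_(i < size p) (p`_i * \sum_(k < N) c k * x k ^+ i)%:E)%E.
  apply: eq_bigr => i _; under eq_integral => t _ do rewrite EFinM.
  by rewrite integralZl//; [rewrite (nu_moments i).2 | exact: (nu_moments i).1].
rewrite sumEFin; congr EFin.
under eq_bigr do rewrite mulr_sumr.
rewrite exchange_big; apply: eq_bigr => k _ /=.
by rewrite horner_coef mulr_sumr; apply: eq_bigr => i _; rewrite mulrCA.
Qed.

Let support : seq R := [seq x k | k <- iota 0 N].

(* The square of [\prod_k ('X - x k)] is nonnegative with zero integral. *)
Lemma ae_mem_support :
  {ae nu, forall t : measurableTypeR R, (t : R) \in support}.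
Proof.
pose q : {poly R} := \prod_(u <- support) ('X - u%:P).
have root_q2 (t : R) : root (q ^+ 2) t = (t \in support).
  by rewrite root_exp ?root_prod_XsubC//; exact: mulrC.
have int0 : (\int[nu]_(t in [set: measurableTypeR R]) `|((q ^+ 2).[t])%:E| = 0)%E.
  under eq_integral => t _ do
    rewrite abse_EFin ger0_norm ?horner_exp ?sqr_ge0// -horner_exp.
  rewrite integral_horner big1// => k _.
  have /rootP -> : root (q ^+ 2) (x k).
    by rewrite root_q2 map_f// mem_iota/=.
  exact: mulr0.
have mq : measurable_fun [set: measurableTypeR R]
    (fun t : measurableTypeR R => ((q ^+ 2).[t])%:E).
  by case/integrableP: (integrable_horner (q ^+ 2)).
have /(ae_eq_integral_abs nu measurableT mq) := int0.
apply: filterS => t /(_ I)[/eqP].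
by rewrite -rootE root_q2.
Qed.

(** Almost everywhere the indicator of [A] equals a polynomial interpolating it on the support, and
    integrals of polynomials are fixed by the moments. *)
Lemma measure_of_moments (A : set (measurableTypeR R)) : measurable A ->
  nu A = (\sum_(k < N) (c k)%:E * \d_(x k : measurableTypeR R) A)%E.
Proof.
move=> mA.
have [p pA] := exists_interpolating_poly (\1_A : R -> R) support.
rewrite -[A in LHS]setIT -integral_indic//.
rewrite (ae_eq_integral (fun t : measurableTypeR R => (p.[t])%:E))//.
- rewrite integral_horner -sumEFin; apply: eq_bigr => k _.
  rewrite EFinM pA ?diracE ?indicE//.
  by apply: map_f; rewrite mem_iota/=.
- exact/measurable_EFinP.
- by case/integrableP: (integrable_horner p).
- by apply: filterS ae_mem_support => t ts _; rewrite pA.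
Qed.

End FiniteMoments.

Lemma b_ge0 (R : realType) (m k : nat) : 0 <= b R m k.
Proof. by rewrite /b divr_ge0// mulr_ge0// sqr_ge0. Qed.

Theorem theorem5p3 (R : realType) (m : nat) :
  exists mu : {measure set (measurableTypeR R) -> \bar R},
    [/\ has_moments mu (fun n => (M n m)%:R),
        (forall nu : {measure set (measurableTypeR R) -> \bar R},
           has_moments nu (fun n => (M n m)%:R) ->
           forall A : set (measurableTypeR R), measurable A -> nu A = mu A)
      & (forall A : set (measurableTypeR R), measurable A ->
           mu A = (\sum_(1 <= k < m.+2) (b R m k)%:E * \d_(z R m k) A)%E)].
Proof.
have momentsE : (fun n => (M n m)%:R) =
    (fun n => \sum_(k < m.+1) b R m k.+1 * z R m k.+1 ^+ n) :> (nat -> R).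
  by apply/funext => n; rewrite M_walks walks_moment.
(* [atomic] numbers its atoms from 0, hence the shift to [k.+1]. *)
exists (atomic (fun k => NngNum (b_ge0 R m k.+1))
               (fun k => z R m k.+1 : measurableTypeR R) m.+1).
rewrite momentsE; split.
- move=> n; have mX : measurable_fun setT (fun t : measurableTypeR R => (t : R) ^+ n).
    exact: exprn_measurable.
  by split; [exact: integrable_atomic | rewrite integral_atomic].
- move=> nu nu_moments A mA; rewrite atomicE.
  exact: (measure_of_moments (c := fun k => b R m k.+1)
                             (x := fun k => z R m k.+1) nu_moments mA).
- by move=> A mA; rewrite atomicE big_add1 big_mkord.
Qed.
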